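(* Let $n\ge 4$ be an integer, let $G$ be a graph, and let $G'\subseteq G$ be a connected subgraph. If $cr(G')=m\ge n$ but $G'\not\cong C_m$, then the sequence $\{HL^k(G)\}_{k\ge 0}$, taken with $H\cong P_n$, diverges by order.
   Context: All graphs are finite, simple and undirected. $P_n$ is the path on $n$ vertices and $C_m$ the cycle on $m$ vertices. Fix $H\cong P_n$. Two edges of a graph $G$ are $P_n$-adjacent if they are distinct, share an endpoint, and both lie in a common subgraph of $G$ isomorphic to $P_n$. The graph $HL(G)$ has vertex set $E(G)$, with two vertices adjacent iff the corresponding edges are $P_n$-adjacent in $G$ (if $G$ has no edges, $HL(G)$ is the graph with no vertices). Set $HL^0(G)=G$ and $HL^{k+1}(G)=HL(HL^k(G))$. The sequence of $G$ diverges by order if for every positive integer $N$ there is an integer $k$ with $|V(HL^k(G))|\ge N$. The circumference $cr(G)$ is the length of a longest cycle of $G$, with $cr(G)=0$ if $G$ has no cycle. *)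

(* Defs.v *)
From mathcomp Require Import all_boot.

Set Implicit Arguments.
Unset Strict Implicit.
Unset Printing Implicit Defensive.

Record sgraph := SGraph {
  vert :> finType;
  adj : rel vert;
  adj_sym : symmetric adj;
  adj_irrefl : irreflexive adj }.

Definition edges (G : sgraph) : {set {set G}} :=
  [set [set xy.1; xy.2] | xy : G * G & adj xy.1 xy.2].

Definition isomorphic (G K : sgraph) : bool :=
  [exists f : {ffun G -> K},
    [&& injectiveb f, [forall z, exists x, f x == z]
      & [forall x, forall y, adj (f x) (f y) == adj x y]]].

Definition connected (G : sgraph) : bool :=
  [forall x : G, forall y : G, connect (@adj G) x y].

Section StandardGraphs.
Variable n : nat.

Definition path_adj : rel 'I_n := [rel i j : 'I_n | (i.+1 == j) || (j.+1 == i)].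

Fact path_adj_sym : symmetric path_adj.
Proof. by move=> i j; rewrite /path_adj /= orbC. Qed.

Fact path_adj_irrefl : irreflexive path_adj.
Proof. by move=> i; rewrite /path_adj /= orbb eqn_leq ltnn. Qed.

Definition path_graph : sgraph := SGraph path_adj_sym path_adj_irrefl.

(* [ordS] is the cyclic successor on 'I_n.  For n < 3 this graph is not a     *)
(* cycle, whence the bound in [circumference].                                *)
Definition cycle_adj : rel 'I_n :=
  [rel i j : 'I_n | (i != j) && ((j == ordS i) || (i == ordS j))].

Fact cycle_adj_sym : symmetric cycle_adj.
Proof. by move=> i j; rewrite /cycle_adj /= eq_sym orbC. Qed.

Fact cycle_adj_irrefl : irreflexive cycle_adj.
Proof. by move=> i; rewrite /cycle_adj /= eqxx. Qed.

Definition cycle_graph : sgraph := SGraph cycle_adj_sym cycle_adj_irrefl.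
End StandardGraphs.

(* A subgraph, not necessarily induced, is a pair of a vertex set and an edge *)
(* set; it is a finite type, so that one can quantify over it in [bool].      *)
Definition subgraph_axiom (G : sgraph) (S : {set G} * {set {set G}}) : bool :=
  (S.2 \subset edges G) && (S.2 \subset powerset S.1).

Definition subgraph (G : sgraph) : finType :=
  {S : {set G} * {set {set G}} | subgraph_axiom S}.

Section Subgraph.
Variables (G : sgraph) (S : subgraph G).

Definition sub_verts : {set G} := (val S).1.
Definition sub_edges : {set {set G}} := (val S).2.

Definition sub_adj : rel {x : G | x \in sub_verts} :=
  [rel x y | [set val x; val y] \in sub_edges].

Fact sub_adj_sym : symmetric sub_adj.
Proof. by move=> x y; rewrite /sub_adj /= setUC. Qed.

Fact sub_adj_irrefl : irreflexive sub_adj.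
Proof.
move=> x; apply/negbTE/negP; rewrite /sub_adj /= => xxE.
have /andP[/subsetP/(_ _ xxE)/imsetP[[u v] /= uv exx] _] := valP S.
rewrite inE /= in uv.
have := set21 u v; have := set22 u v.
rewrite -exx !inE !orbb => /eqP ev /eqP eu.
by rewrite eu ev adj_irrefl in uv.
Qed.

Definition sub_graph : sgraph := SGraph sub_adj_sym sub_adj_irrefl.
End Subgraph.

Section HLineGraph.
Variables H G : sgraph.

Definition H_adjacent (e f : {set G}) : bool :=
  [&& e != f, e :&: f != set0
    & [exists S : subgraph G,
        [&& isomorphic (sub_graph S) H, e \in sub_edges S
          & f \in sub_edges S]]].

Definition HL_adj : rel {e : {set G} | e \in edges G} :=
  [rel e f | H_adjacent (val e) (val f)].

Fact HL_adj_sym : symmetric HL_adj.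
Proof.
move=> e f; rewrite /HL_adj /= /H_adjacent eq_sym setIC; do 2 congr (_ && _).
by apply: eq_existsb => S; congr (_ && _); rewrite andbC.
Qed.

Fact HL_adj_irrefl : irreflexive HL_adj.
Proof. by move=> e; rewrite /HL_adj /= /H_adjacent eqxx. Qed.

Definition HL : sgraph := SGraph HL_adj_sym HL_adj_irrefl.
End HLineGraph.

(* No cycle has more than #|G| vertices, and an empty \max is 0.              *)
Definition circumference (G : sgraph) : nat :=
  \max_(m < #|G|.+1 | (3 <= m) &&
          [exists S : subgraph G, isomorphic (sub_graph S) (cycle_graph m)]) m.

Definition diverges_by_order (H G : sgraph) : Prop :=
  forall N : nat, 0 < N -> exists k : nat, N <= #|iter k (HL H) G|.

(* Main.v *)
(** A cycle [v0 v1 ... v_(m-1)] of length [m >= n] together with a non-cycle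
    edge [e] at [v0] yields the closed sequence [e, v0v1, ..., v_(m-1)v0] of
    edges, in which consecutive edges are [P_n]-adjacent: it is a cycle of
    length [m + 1] in [HL(G)], and [v_(m-1)v0, v0v1] is a chord of it.  So
    the configuration persists, and its cycle grows by one at every step.  A
    connected graph containing, but not isomorphic to, [C_m] provides such a
    configuration. *)

Require Import Defs.
From mathcomp Require Import all_boot.
From mathcomp Require Import zify.

Set Implicit Arguments.
Unset Strict Implicit.
Unset Printing Implicit Defensive.

(** * Isomorphisms, edges and adjacency in subgraphs *)

Lemma isomorphicP (G K : sgraph) :
  reflect
    (exists f : G -> K, bijective f /\ forall x y, adj (f x) (f y) = adj x y)
          (isomorphic G K).
Proof.
apply: (iffP existsP) => [[f /and3P[/injectiveP inj_f /forallP surj_f adj_f]]|].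
  exists f; split=> [|x y]; last by move/forallP/(_ x)/forallP/(_ y)/eqP: adj_f.
  have g z : {x | f x == z} by apply/sigW/existsP/surj_f.
  exists (fun z => sval (g z)) => [x|z]; last by case: (g z) => x /= /eqP.
  by apply: inj_f; case: (g _) => x' /= /eqP.
case=> f [[g fK gK] adj_f]; exists (finfun f); apply/and3P; split.
- by apply/injectiveP => x y; rewrite !ffunE => /(can_inj fK).
- by apply/forallP => z; apply/existsP; exists (g z); rewrite ffunE gK.
- by apply/forallP => x; apply/forallP => y; rewrite !ffunE adj_f.
Qed.

Lemma isomorphic_sym (G K : sgraph) : isomorphic G K -> isomorphic K G.
Proof.
case/isomorphicP=> f [[g fK gK] adj_f]; apply/isomorphicP; exists g; split.
  by exists f.
by move=> x y; rewrite -adj_f !gK.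
Qed.

Lemma isomorphic_trans (G K L : sgraph) :
  isomorphic G K -> isomorphic K L -> isomorphic G L.
Proof.
case/isomorphicP=> f [bij_f adj_f] /isomorphicP[g [bij_g adj_g]].
apply/isomorphicP; exists (g \o f); split; first exact: bij_comp.
by move=> x y; rewrite /= adj_g adj_f.
Qed.

Lemma set2_eq (T : finType) (a b c d : T) :
  [set a; b] = [set c; d] -> (a = c /\ b = d) \/ (a = d /\ b = c).
Proof.
move=> e; have := set21 a b; have := set22 a b; rewrite e !inE.
have := set21 c d; have := set22 c d; rewrite -e !inE.
by move=> /orP[]/eqP-> /orP[]/eqP-> /orP[]/eqP ? /orP[]/eqP ?; subst; auto.
Qed.

Lemma mem_edges (G : sgraph) (x y : G) : ([set x; y] \in edges G) = adj x y.
Proof.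
apply/imsetP/idP => [[[a b]]|xy]; last first.
  by exists (x, y); rewrite ?inE.
rewrite inE /= => ab /set2_eq[] [-> ->] //.
by rewrite adj_sym.
Qed.

Lemma sub_adj_adj (G : sgraph) (S : subgraph G) (x y : sub_graph S) :
  adj x y -> adj (val x) (val y).
Proof.
rewrite -[adj (val x) _]mem_edges => xyS.
by have /andP[/subsetP/(_ _ xyS)] := valP S.
Qed.

(** * Path subgraphs from duplicate-free walks *)

Section PathSubgraph.
Variables (G : sgraph) (n : nat) (x0 : G) (w : seq G).
Hypotheses (uniq_w : uniq w) (size_w : size w = n) (path_w : sorted (@adj G) w).

Let S := ([set x in w],
  [set [set nth x0 w i; nth x0 w i.+1] | i : 'I_n & i.+1 < n]).

Let S_subgraph : subgraph_axiom S.
Proof.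
apply/andP; split; apply/subsetP => _ /imsetP[i /[!inE] lt_i ->].
  by rewrite mem_edges; apply/(sortedP x0); rewrite ?size_w.
apply/subsetP => z; rewrite !inE.
by case/orP=> /eqP->; apply: mem_nth; rewrite size_w.
Qed.

Let P : subgraph G := exist _ S S_subgraph.

(** Only edges between consecutive entries of [w] are kept, so chords of [w] in [G] do not spoil the
    isomorphism. Its inverse is [index], as [w] has no repetition. *)
Lemma path_subgraph : exists P : subgraph G,
  isomorphic (sub_graph P) (path_graph n) /\
  forall i, i.+1 < n -> [set nth x0 w i; nth x0 w i.+1] \in sub_edges P.
Proof.
exists P; split=> [|i lt_i]; last first.
  by apply/imsetP; exists (Ordinal (ltnW lt_i)); rewrite ?inE.
apply/isomorphic_sym/isomorphicP.
have in_w (i : 'I_n) : nth x0 w i \in sub_verts P.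
  by rewrite inE mem_nth // size_w.
have index_lt (x : sub_graph P) : index (val x) w < n.
  by have := valP x; rewrite inE -index_mem size_w.
exists (fun i : path_graph n => exist _ (nth x0 w i) (in_w i)); split.
  exists (fun x : sub_graph P => Ordinal (index_lt x)) => [i|x].
    by apply: val_inj; rewrite /= index_uniq ?size_w.
  by apply: val_inj; rewrite /= nth_index //; have := valP x; rewrite inE.
move=> i j; rewrite [LHS]/=.
have nth_inj a b : a < n -> b < n -> nth x0 w a = nth x0 w b -> a = b.
  by move=> an bn /eqP; rewrite nth_uniq ?size_w // => /eqP.
apply/imsetP/orP => [[k]|[]/eqP eij].
- rewrite inE => lt_k /= /set2_eq[[]|[]] /nth_inj-> // /nth_inj-> //.
    by left.
  by right.
- by exists i; rewrite ?inE eij.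
- by exists j; rewrite ?inE eij // setUC.
Qed.

End PathSubgraph.

(** * Sufficient conditions for $P_n$-adjacency *)

Section Growth.
Variables (n : nat) (H : sgraph).
Hypotheses (n_ge4 : 4 <= n) (H_path : isomorphic H (path_graph n)).

Section HAdjacent.
Variable G : sgraph.

Lemma H_adjacent_sym : symmetric (@H_adjacent H G).
Proof.
move=> e f; rewrite /H_adjacent eq_sym setIC; do 2 congr (_ && _).
by apply: eq_existsb => S; congr (_ && _); rewrite andbC.
Qed.

Lemma H_adjacent_path (a b c : G) (l r : seq G) (q := l ++ [:: a, b, c & r]) :
  uniq q -> sorted (@adj G) q -> n <= size q ->
  H_adjacent H [set a; b] [set b; c].
Proof.
move=> uniq_q path_q le_nq; set i := size l.
have size_q : size q = i + (size r).+3 by rewrite size_cat.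
have nth_q j : nth a q (i + j) = nth a [:: a, b, c & r] j.
  by rewrite /q nth_cat ltnNge leq_addr addKn.
have /and3P[neq_ab neq_ac neq_bc] : [&& a != b, a != c & b != c].
  have := uniq_q; rewrite cat_uniq => /and3P[_ _ /=].
  by rewrite !inE !negb_or -!andbA => /and5P[-> -> _ ->].
apply/and3P; split.
- by apply/eqP => /set2_eq[[/eqP e _]|[/eqP e _]]; rewrite e in neq_ab neq_ac.
- by apply/set0Pn; exists b; rewrite !inE eqxx orbT.
(* The window [w] of [n] vertices starts at [a], or is the final one of [q] if that would overrun.
   Either way it contains [a], [b] and [c]. *)
pose k := minn i (size q - n); pose w := take n (drop k q).
have size_w : size w = n by rewrite size_takel // size_drop /k; lia.
have nth_w j : j < 3 -> nth a w (i - k + j) = nth a [:: a, b, c & r] j.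
  move=> lt_j; rewrite nth_take ?nth_drop; last by lia.
  by rewrite addnA subnKC ?geq_minl // nth_q.
have [||P [isoP edgeP]] := @path_subgraph G n a w _ size_w.
- exact/take_uniq/drop_uniq.
- exact/take_sorted/drop_sorted.
apply/existsP; exists P; apply/and3P; split.
- exact: isomorphic_trans isoP (isomorphic_sym H_path).
- have := edgeP (i - k + 0); rewrite -addnS !nth_w //=; apply; lia.
- have := edgeP (i - k + 1); rewrite -addnS !nth_w //=; apply; lia.
Qed.

(** The vertex [x] may lie off the cycle, in which case it is prepended to the path [v0, v1, ...].
    On the cycle, it may even be the other neighbour of [v0]. *)
Lemma H_adjacent_chord (v0 v1 x : G) (p : seq G) :
  uniq [:: v0, v1 & p] -> cycle (@adj G) [:: v0, v1 & p] ->
  n <= (size p).+2 -> adj v0 x -> x != v1 ->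
  H_adjacent H [set x; v0] [set v0; v1].
Proof.
move=> uniq_s cycle_s le_n v0x neq_x.
have path_s : path (@adj G) v0 (v1 :: p).
  by move: cycle_s; rewrite /cycle rcons_path => /andP[].
have [x_p | x_p] := boolP (x \in v1 :: p); last first.
  apply: (@H_adjacent_path _ _ _ [::] p).
  - rewrite cat0s cons_uniq uniq_s inE negb_or x_p !andbT.
    by apply: contraTneq v0x => ->; rewrite adj_irrefl.
  - by rewrite cat0s /= adj_sym v0x.
  - exact: leqW.
move: x_p; rewrite inE (negPf neq_x) /= => /splitPr x_p.
case: x_p uniq_s path_s le_n => p1 p2 uniq_s path_s le_n {cycle_s}.
rewrite H_adjacent_sym setUC (setUC [set x]).
(* Both edges lie on the Hamiltonian path of the cycle that leaves [x] through
   the chord and then follows the arc from [v0] to the predecessor of [x]. *)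
have q_perm :
    perm_eq (rev p1 ++ [:: v1, v0, x & p2]) [:: v0, v1 & p1 ++ x :: p2].
  have -> : rev p1 ++ [:: v1, v0, x & p2] = rev (v1 :: p1) ++ v0 :: x :: p2.
    by rewrite rev_cons cat_rcons.
  rewrite -(cat1s v0 (x :: p2)) perm_catCA /= perm_cons -cat_cons perm_cat2r.
  by rewrite perm_rev.
apply: (@H_adjacent_path _ _ _ (rev p1) p2).
- by rewrite (perm_uniq q_perm).
- have -> : rev p1 ++ [:: v1, v0, x & p2] = rev [:: v0, v1 & p1] ++ x :: p2.
    by rewrite !rev_cons !cat_rcons.
  rewrite sorted_cat_cons -rev_cons rev_sorted.
  rewrite (eq_sorted (fun y z => adj_sym z y)).
  move: path_s; rewrite -cat_cons cat_path /= => /andP[-> /andP[_ ->]].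
  by rewrite adj_sym v0x.
- by rewrite (perm_size q_perm).
Qed.

(** Rotated to start at [x], the cycle read as a path has the two edges at its head. *)
Lemma H_adjacent_next (s : seq G) (x : G) :
  uniq s -> cycle (@adj G) s -> n <= size s -> x \in s ->
  H_adjacent H [set x; next s x] [set next s x; next s (next s x)].
Proof.
move=> uniq_s cycle_s le_n /rot_to[i s' def_s].
rewrite -!(next_rot i uniq_s).
have := uniq_s; have := cycle_s; have := le_n.
rewrite -(rot_uniq i) -(rot_cycle i) -(size_rot i) def_s.
case: s' {def_s} => [|b [|c r]] /= {}le_n {}cycle_s {}uniq_s; [lia..|].
have neq_xb : (x == b) = false.
  by apply: contraNF (andP uniq_s).1 => /eqP->; rewrite mem_head.
rewrite eqxx eq_sym neq_xb eqxx.
apply: (@H_adjacent_path _ _ _ [::] r) => //=.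
by move: cycle_s; rewrite rcons_path => /and4P[-> -> ->].
Qed.

(** A collision at distinct [x] and [y] would make each the successor of the other, forcing a cycle
    of length 2. *)
Lemma next_edge_inj (s : seq G) :
  uniq s -> 2 < size s -> {in s &, injective (fun x => [set x; next s x])}.
Proof.
move=> uniq_s size_s x y x_s y_s /set2_eq[[]//|[def_x def_y]].
have : next s (next s x) = x by rewrite def_y -def_x.
have [i s' def_s] := rot_to x_s.
rewrite -!(next_rot i uniq_s) def_s.
have := size_s; have := uniq_s; rewrite -(rot_uniq i) -(size_rot i) def_s.
case: s' {def_s} => [|b [|c r]] //= {}uniq_s _.
have neq_xb : (x == b) = false.
  by apply: contraNF (andP uniq_s).1 => /eqP->; rewrite mem_head.
rewrite eqxx eq_sym neq_xb eqxx => def_c.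
by rewrite def_c !inE eqxx orbT in uniq_s.
Qed.
End HAdjacent.

(** * Growth of decorated cycles under [HL] *)

(** Only the two cycle neighbours of [v0] are forbidden for [x]: the extra edge may be a chord or a
    pendant edge. *)
Definition decorated_cycle (G : sgraph) (m : nat) : Prop :=
  exists v0 v1 p x, let s : seq G := [:: v0, v1 & p] in
    [/\ uniq s, cycle (@adj G) s, size s = m
      & [/\ adj v0 x, x != v1 & x != last v1 p]].

(** The growth step is first carried out on edges as plain sets; the next lemma transports it to the
    subtype of vertices of [HL H G]. *)
Lemma decorated_cycle_HL_edges (G : sgraph) (m : nat) :
  n <= m -> decorated_cycle G m ->
  exists f0 f1 q h, let s : seq {set G} := [:: f0, f1 & q] in
    [/\ uniq s, cycle (H_adjacent H (G := G)) s, size s = m.+1,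
        {subset s <= edges G}
      & [/\ h \in s, H_adjacent H f0 h, h != f1 & h != last f1 q]].
Proof.
move=> le_nm [v0 [v1 [p [x]]]]; set s := [:: v0, v1 & p].
case=> uniq_s cycle_s size_s [v0x x_neq_v1 x_neq_last].
have size_p : (size p).+2 = m by [].
pose E y := [set y; next s y]; pose e := [set x; v0].
have next_v0 : next s v0 = v1 by rewrite /= eqxx.
pose l := last v1 p.
have l_s : l \in s by rewrite inE mem_last orbT.
pose r := belast v0 (v1 :: p).
have rot_s : rot (size r) s = l :: r by rewrite /s lastI -cats1 rot_size_cat.
have next_l : next s l = v0.
  by rewrite -(next_rot (size r) uniq_s) rot_s /= eqxx.
have E_inj : {in s &, injective E} by apply: next_edge_inj; lia.
have E_edge y : y \in s -> E y \in edges G.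
  by move=> y_s; rewrite mem_edges; apply: next_cycle.
have e_edge : e \in edges G by rewrite mem_edges adj_sym.
(* The only cycle edges at [v0] are [E l] and [E v0]; equality with [e] would give [x = l] or
   [x = v1]. *)
have e_notin : e \notin map E s.
  apply/mapP => -[y y_s /set2_eq[[def_x def_v0]|[def_x def_v0]]].
    case/negP: x_neq_last; apply/eqP; rewrite def_x.
    by apply: (can_inj (prev_next uniq_s)); rewrite -def_v0 next_l.
  by case/negP: x_neq_v1; rewrite def_x -def_v0 next_v0.
have E_adj y : y \in s -> H_adjacent H (E y) (E (next s y)).
  by move=> y_s; apply: H_adjacent_next => //; rewrite size_s.
have e_v0 : H_adjacent H e (E v0).
  by rewrite /E next_v0; apply: (@H_adjacent_chord _ _ _ _ p); rewrite ?size_p.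
have e_l : H_adjacent H (E l) e.
  (* The chord lemma is applied to the cycle traversed backwards, [v0, l, ..., v1]. *)
  rewrite H_adjacent_sym /E next_l setUC.
  have def_l : rev (v1 :: p) = l :: behead (rev (v1 :: p)).
    by rewrite lastI rev_rcons.
  apply: (@H_adjacent_chord _ v0 l x (behead (rev (v1 :: p)))) => //.
  - rewrite -def_l cons_uniq mem_rev rev_uniq; exact: uniq_s.
  - rewrite -def_l -(rot_cycle 1) rot1_cons -rev_cons rev_cycle.
    by rewrite (eq_cycle (fun y z => adj_sym z y)).
  - by rewrite size_behead size_rev /= size_p.
(* The new base point [E v0] has cycle neighbours [E v1] and [e]; its old neighbour [E l] becomes
   the end of a chord. *)
exists (E v0), (E v1), (rcons (map E p) e), (E l); split.
- have -> : [:: E v0, E v1 & rcons (map E p) e] = rcons (map E s) e by [].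
  by rewrite rcons_uniq e_notin map_inj_in_uniq.
(* The closing step from [E l] to [E v0] is replaced by the detour through [e]. *)
- have : cycle (H_adjacent H (G := G)) (map E s).
    by rewrite cycle_map; apply: cycle_from_next.
  rewrite /= !rcons_path last_rcons last_map -/l => /and3P[-> -> _] /=.
  by rewrite e_l e_v0.
- by rewrite /= size_rcons size_map size_p.
- move=> f; rewrite -[_ :: _]/(rcons (map E s) e) mem_rcons inE.
  by case/orP=> [/eqP->//|/mapP[y /E_edge ? ->]].
- rewrite last_rcons; split.
  + by rewrite -[_ :: _]/(rcons (map E s) e) mem_rcons inE map_f ?orbT.
  + by rewrite H_adjacent_sym -next_l E_adj.
  (* The vertices [l] and [v1] sit at positions [m - 1] and [1], which differ because [m >= 4]. *)
  + apply/eqP => /E_inj; rewrite -/s l_s !inE eqxx orbT => /(_ isT isT) def_l.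
    have : nth v0 s (size s).-1 == nth v0 s 1 by rewrite nth_last; apply/eqP.
    by rewrite nth_uniq //; lia.
  + by apply: contraNneq e_notin => <-; rewrite map_f.
Qed.

Lemma decorated_cycle_HL (G : sgraph) (m : nat) :
  n <= m -> decorated_cycle G m -> decorated_cycle (HL H G) m.+1.
Proof.
move=> le_nm /(decorated_cycle_HL_edges le_nm)[f0 [f1 [q [h]]]].
set s := [:: f0, f1 & q] => -[uniq_s cycle_s size_s s_edge].
case=> h_s adj_h h_neq_f1 h_neq_last.
have [f0_s f1_s] : f0 \in s /\ f1 \in s by rewrite !inE !eqxx orbT.
(* The default [f0] is never reached on [s], whose members are all edges. *)
pose L (f : {set G}) : HL H G := insubd (exist _ f0 (s_edge _ f0_s)) f.
have LK f : f \in s -> val (L f) = f.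
  by move=> f_s; rewrite insubdK //; exact: (s_edge f).
have L_inj : {in s &, injective L}.
  by move=> f g f_s g_s /(congr1 val); rewrite !LK.
have L_adj : {in s &, forall f g, H_adjacent H f g -> adj (L f) (L g)}.
  by move=> f g f_s g_s fg; rewrite /= /HL_adj /= !LK.
exists (L f0), (L f1), (map L q), (L h).
rewrite -[_ :: _]/(map L s); split.
- by rewrite map_inj_in_uniq.
- by apply: (homo_cycle_in (P := mem s) L_adj _ cycle_s); apply/allP.
- by rewrite size_map.
rewrite last_map; split; first exact: L_adj.
  by apply: contraNneq h_neq_f1 => /L_inj->.
apply: contraNneq h_neq_last => /L_inj-> //.
by rewrite inE mem_last orbT.
Qed.

(** After [N] iterations the cycle alone supplies [m + N] distinct vertices. *)
Lemma decorated_cycle_diverges (G : sgraph) (m : nat) :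
  n <= m -> decorated_cycle G m -> diverges_by_order H G.
Proof.
move=> le_nm cycG N _; exists N.
have [v0 [v1 [p [_ [uniq_s _ size_s _]]]]] :
    decorated_cycle (iter N (HL H) G) (m + N).
  elim: N => [|N IH]; first by rewrite addn0.
  rewrite addnS iterS; apply: decorated_cycle_HL IH.
  exact: leq_trans (leq_addr _ _).
by rewrite (leq_trans (leq_addl m N)) // -size_s -(card_uniqP uniq_s) max_card.
Qed.
End Growth.

(** * Finding a decorated cycle *)

(** Positivity excludes the empty maximum, so the value is attained by an actual cycle. *)
Lemma circumference_cycle (G : sgraph) (m : nat) :
  circumference G = m -> 0 < m ->
  exists2 c : 'I_m -> G, injective c & forall i, adj (c i) (c (ordS i)).
Proof.
rewrite /circumference => def_m m_gt0.
set A := (X in \max_(i < _ | X i) _) in def_m.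
have [|i /andP[m_ge3 /existsP[S iso_S]]] :=
  @eq_bigmax_cond _ A (@nat_of_ord _).
  rewrite lt0n; apply: contraTneq m_gt0 => /eqP/pred0P A0.
  by rewrite -def_m big_pred0.
case/isomorphic_sym/isomorphicP: iso_S => f [bij_f adj_f].
rewrite [LHS]def_m => def_i; rewrite def_i in f bij_f adj_f m_ge3 *.
exists (val \o f) => [|j]; first exact: inj_comp val_inj (bij_inj bij_f).
apply: sub_adj_adj; rewrite adj_f /= /cycle_adj /= eqxx /= andbT -val_eqE /=.
(* It remains to see that [j] differs from its cyclic successor; the wrap-around at [m - 1] is a
   separate case. *)
have := ltn_ord j; rewrite leq_eqVlt => /orP[/eqP e|lt_j].
  by rewrite e modnn -lt0n -ltnS e ltnW.
by rewrite modn_small // neq_ltn ltnSn.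
Qed.

(** Either some cycle vertex has a neighbour besides its two cycle neighbours, which is a
    decoration, or the cycle is closed under adjacency and has no chord, so by connectedness it is
    all of [G]. *)
Lemma connected_decorated_cycle (G : sgraph) (m : nat) (c : 'I_m -> G) :
  2 < m -> injective c -> (forall i, adj (c i) (c (ordS i))) ->
  connected G -> ~~ isomorphic G (cycle_graph m) -> decorated_cycle G m.
Proof.
case: m c => [//|m'] c; set m := m'.+1 => m_gt2 inj_c adj_c conn_G not_cycle.
have [|no_extra] := boolP [exists i, exists x,
    [&& adj (c i) x, x != c (ordS i) & x != c (ord_pred i)]].
  case/existsP=> i /existsP[x /and3P[adj_x x_neq_next x_neq_prev]].
  (* The walk [f] goes round the cycle from the decorated vertex [c i], so that this vertex comes
     first in the list. *)
  pose f k := c (iter k (@ordS m) i).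
  have adj_f k : adj (f k) (f k.+1) by apply: adj_c.
  have val_iter k : iter k (@ordS m) i = (i + k) %% m :> nat.
    elim: k => [|k /= ->]; first by rewrite addn0 modn_small.
    by rewrite -addn1 modnDml addn1 addnS.
  have iter_m : iter m (@ordS m) i = i.
    by apply: ord_inj; rewrite val_iter modnDr modn_small.
  have last_iota k a : last a (iota a.+1 k) = a + k.
    by elim: k a => [|k IH] a; rewrite /= ?addn0 // IH addSnnS.
  have m'_gt0 : 0 < m' by lia.
  exists (f 0), (f 1), [seq f k | k <- iota 2 m'.-1], x.
  rewrite last_map last_iota add1n prednK //.
  have -> : [:: f 0, f 1 & [seq f k | k <- iota 2 m'.-1]] =
      [seq f k | k <- iota 0 m].
    by rewrite /m -{2}(prednK m'_gt0).
  split=> [|||/=].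
  - rewrite map_inj_in_uniq ?iota_uniq // => j k.
    rewrite !mem_iota /= !add0n => lt_j lt_k /inj_c/(congr1 val)/= /eqP.
    by rewrite !val_iter eqn_modDl !modn_small // => /eqP.
  (* Since [f m = f 0], closing the list amounts to walking on to [f m]. *)
  - have -> : cycle (@adj G) [seq f k | k <- iota 0 m] =
        path (@adj G) (f 0) [seq f k | k <- iota 1 m].
      have -> : iota 1 m = rcons (iota 1 m') m.
        by rewrite -cats1 -(iotaD 1 m' 1) addn1.
      by rewrite map_rcons [f m]/f iter_m.
    rewrite path_map; apply/(pathP 0) => k; rewrite size_iota => lt_k.
    rewrite -[_ :: _]/(iota 0 m.+1) !nth_iota //; last exact: ltnW.
    exact: adj_f.
  - by rewrite size_map size_iota.
  (* Writing [i] as its [m]-th successor identifies [c (ord_pred i)] with [f m'], the last entry of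
     the list. *)
  by split=> //; rewrite /f -{1}iter_m iterS ordSK in x_neq_prev *.
case/negP: not_cycle; apply/isomorphic_sym/isomorphicP.
have nbr i x : adj (c i) x -> x = c (ordS i) \/ x = c (ord_pred i).
  move=> adj_x; move/existsPn: no_extra => /(_ i)/existsPn/(_ x).
  by rewrite adj_x -negb_or negbK => /orP[]/eqP; auto.
exists c; split.
  have c_surj y : y \in codom c.
    have /forallP/(_ (c ord0))/forallP/(_ y) := conn_G.
    move/closed_connect <-; first exact: codom_f.
    apply: intro_closed => [|u v uv /codomP[i def_u]].
      exact/sym_connect_sym/adj_sym.
    by move: uv; rewrite def_u => /nbr[] ->; apply: codom_f.
  exists (fun y => iinv (c_surj y)) => [i|y]; last exact: f_iinv.
  by apply: inj_c; rewrite f_iinv.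
move=> i j; apply/idP/andP => [adj_ij|[_ /orP[]/eqP->]]; last 2 first.
- exact: adj_c.
- by rewrite adj_sym.
split; first by apply: contraTneq adj_ij => ->; rewrite adj_irrefl.
case: (nbr _ _ adj_ij) => /inj_c->; first by rewrite eqxx.
by rewrite ord_predK eqxx orbT.
Qed.

(** A decorated cycle asserts adjacencies and distinctness but no non-adjacency, so it survives in
    [G] even if [S] is not induced. *)
Lemma decorated_cycle_sub (G : sgraph) (S : subgraph G) (m : nat) :
  decorated_cycle (sub_graph S) m -> decorated_cycle G m.
Proof.
case=> v0 [v1 [p [x [uniq_s cycle_s size_s [v0x neq_v1 neq_last]]]]].
exists (val v0), (val v1), (map val p), (val x) => s.
rewrite /s -[_ :: _]/(map val [:: v0, v1 & p]).
rewrite map_inj_uniq; last exact: val_inj.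
rewrite size_map last_map !(inj_eq val_inj); split=> //; last first.
  by split=> //; apply: sub_adj_adj v0x.
by apply: homo_cycle cycle_s; apply: sub_adj_adj.
Qed.

Theorem theorem2p3 (n : nat) (H G : sgraph) (G' : subgraph G) (m : nat)
  (n_ge4 : 4 <= n)
  (H_path : isomorphic H (path_graph n))
  (G'_connected : connected (sub_graph G'))
  (G'_circumference : circumference (sub_graph G') = m)
  (m_ge_n : n <= m)
  (G'_not_cycle : ~~ isomorphic (sub_graph G') (cycle_graph m)) :
  diverges_by_order H G.
Proof.
have m_ge4 := leq_trans n_ge4 m_ge_n.
have [|c inj_c adj_c] := circumference_cycle G'_circumference; first lia.
apply: (decorated_cycle_diverges n_ge4 H_path m_ge_n).
apply: (@decorated_cycle_sub _ G').
apply: connected_decorated_cycle inj_c adj_c _ _ => //; lia.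
Qed.
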